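(* For all $d\ge 3$, the maximal number $f(d)$ of facets of a $d$-dimensional edge polytope of a connected graph satisfies \[ 4^{\lfloor d/3\rfloor}<f(d)\le 2^d+d. \]
   Context: All graphs are finite, undirected, without loops, multiple edges or isolated vertices. For a graph $G$ on vertex set $[n]$, the edge polytope is $\mathcal{P}(G)=\mathrm{conv}\{e_i+e_j : \{i,j\}\in E(G)\}\subseteq\mathbb{R}^n$. $f(d)$ denotes the maximum number of facets of $\mathcal{P}(G)$ over all connected graphs $G$ with $\dim(\mathcal{P}(G))=d$. *)

(* Defs.v *)
From HB Require Import structures.
From mathcomp Require Import all_boot all_order all_algebra.
From mathcomp Require Import all_classical all_reals convex.

Set Implicit Arguments.
Unset Strict Implicit.
Unset Printing Implicit Defensive.

Import Order.TTheory GRing.Theory Num.Theory.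
Local Open Scope classical_set_scope.
Local Open Scope ring_scope.

(* The vertex set {1, ..., n} is 'I_n. *)
Record graph (n : nat) := Graph {
  adj :> rel 'I_n;
  adj_sym : symmetric adj;
  adj_irrefl : irreflexive adj;
  adj_no_isolated : forall i, exists j, adj i j
}.

Definition connected_graph (n : nat) (G : graph n) : Prop :=
  (0 < n)%N /\ forall i j : 'I_n, connect (adj G) i j.

Section Polytopes.
Context {R : realType} {n : nat}.
Implicit Types (A P F : set 'rV[R]_n).

Definition conv_hull A : set 'rV[R]_n :=
  smallest (@convex_set R 'rV[R]_n) A.

Definition affinely_independent (k : nat) (p : 'I_k -> 'rV[R]_n) : Prop :=
  forall c : 'I_k -> R,
    \sum_(i < k) c i = 0 -> \sum_(i < k) c i *: p i = 0 -> forall i, c i = 0.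

(* The affine dimension of A is k: the largest affinely independent families
   of points of A have k + 1 members.  The empty set has no dimension. *)
Definition has_dim A (k : nat) : Prop :=
  (exists p : 'I_k.+1 -> 'rV[R]_n,
     (forall i, A (p i)) /\ affinely_independent p) /\
  (forall (m : nat) (p : 'I_m -> 'rV[R]_n),
     (forall i, A (p i)) -> affinely_independent p -> (m <= k.+1)%N).

(* c = 0 is allowed, so P itself is a face of P, and so is the empty set
   when P is bounded; the dimension condition in is_facet excludes both. *)
Definition is_face P F : Prop :=
  exists (c : 'rV[R]_n) (b : R),
    (forall x, P x -> \sum_(i < n) c 0 i * x 0 i <= b) /\
    F = P `&` [set x | \sum_(i < n) c 0 i * x 0 i = b].

Definition is_facet P F : Prop :=
  is_face P F /\ exists k : nat, has_dim P k.+1 /\ has_dim F k.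

End Polytopes.

Definition edge_polytope (R : realType) (n : nat) (G : graph n) :
    set 'rV[R]_n :=
  conv_hull [set x | exists i j : 'I_n,
    adj G i j /\ x = delta_mx 0 i + delta_mx 0 j].
Arguments edge_polytope R {n} G.

Definition has_facets (R : realType) (n : nat) (G : graph n) (m : nat) : Prop :=
  ([set F | is_facet (edge_polytope R G) F] #= `I_m)%card.

(* f(d) = m, where the maximum is over graphs on any number n of vertices. *)
Definition is_max_facets (R : realType) (d m : nat) : Prop :=
  (exists (n : nat) (G : graph n),
     [/\ connected_graph G, has_dim (edge_polytope R G) d
       & has_facets R G m]) /\
  (forall (n : nat) (G : graph n) (k : nat),
     connected_graph G -> has_dim (edge_polytope R G) d ->
     has_facets R G k -> (k <= m)%N).

(* Main.v *)
Require Import Defs.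
From mathcomp Require Import all_boot all_order all_algebra.
From mathcomp Require Import all_classical all_reals.
From mathcomp Require Import interval_inference convex ring lra zify.

(** Upper bound.  A facet is cut out by a functional [c] that is nonnegative on
    edge vectors, and every functional that vanishes on the tight edges, but not
    on all edges, cuts out the same facet.  If [c >= 0], some coordinate x_i
    does it.  Otherwise, let T be the set of minimisers of [c]; then the
    functional sum_{N(T)} x_j - sum_T x_j does it, and T is independent.  In a
    non-bipartite graph a vertex set and its complement are never both
    independent, so at most half of the 2^(d+1) vertex sets occur.  In a
    bipartite graph [c] can be normalised so that T lies in the smaller side.

    Lower bound.  Join an apex v to d %/ 3 disjoint triangles and d %% 3 pendant
    vertices.  Choosing at most one vertex in each triangle, and adding all
    pendant vertices, gives 4^(d %/ 3) sets T with distinct facets; they all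
    have coefficient 1 at v, unlike x_i = 0 for a triangle vertex i. *)

Set Implicit Arguments.
Unset Strict Implicit.
Unset Printing Implicit Defensive.

Import Order.TTheory GRing.Theory Num.Theory.
Local Open Scope classical_set_scope.
Local Open Scope card_scope.
Local Open Scope ring_scope.

(** * Linear functionals, and affine dimension as matrix rank *)

Section LinearFunctionals.
Context {R : realType} {n : nat}.
Implicit Types (c h x y : 'rV[R]_n) (E : {set 'I_n * 'I_n}).

Definition dot c x : R := \sum_(i < n) c 0 i * x 0 i.

Lemma dot_mx m (B : 'M[R]_(m, n)) c i : (B *m c^T) i 0 = dot c (row i B).
Proof. by rewrite mxE; apply: eq_bigr => j _; rewrite !mxE mulrC. Qed.

Lemma dotDr c x y : dot c (x + y) = dot c x + dot c y.
Proof. by rewrite -big_split; apply: eq_bigr => i _; rewrite mxE mulrDr. Qed.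

Lemma dotZr c a x : dot c (a *: x) = a * dot c x.
Proof. by rewrite mulr_sumr; apply: eq_bigr => i _; rewrite mxE mulrCA. Qed.

Lemma dotDl c h x : dot (c + h) x = dot c x + dot h x.
Proof. by rewrite -big_split; apply: eq_bigr => i _; rewrite mxE mulrDl. Qed.

Lemma dotZl a c x : dot (a *: c) x = a * dot c x.
Proof. by rewrite mulr_sumr; apply: eq_bigr => i _; rewrite mxE mulrA. Qed.

Lemma dot0l x : dot 0 x = 0.
Proof. by rewrite -(scale0r 0) dotZl mul0r. Qed.

Lemma dot_delta c i : dot c (delta_mx 0 i) = c 0 i.
Proof.
rewrite /dot (bigD1 i) //= mxE !eqxx mulr1 big1 ?addr0 // => j /negbTE ji.
by rewrite mxE ji mulr0.
Qed.

Lemma dot_edge c (i j : 'I_n) :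
  dot c (delta_mx 0 i + delta_mx 0 j) = c 0 i + c 0 j.
Proof. by rewrite dotDr !dot_delta. Qed.

Lemma sub_ker_dot m (B : 'M[R]_(m, n)) c :
  (forall i, dot c (row i B) = 0) -> (B <= kermx c^T)%MS.
Proof.
move=> cB; apply/sub_kermxP/matrixP => i j.
by rewrite ord1 dot_mx cB mxE.
Qed.

Lemma dot_sub m (B : 'M[R]_(m, n)) c x :
  (forall i, dot c (row i B) = 0) -> (x <= B)%MS -> dot c x = 0.
Proof.
move=> cB /submx_trans/(_ (sub_ker_dot cB))/sub_kermxP/matrixP/(_ 0 0).
by rewrite dot_mx mxE row_id.
Qed.

Lemma affinely_independent_row k (A : 'M[R]_(k, n)) :
  row_free A -> affinely_independent (fun i => row i A).
Proof.
move=> freeA c _ cA i.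
have : (\row_i c i) *m A == 0.
  by rewrite -cA mulmx_sum_row; apply/eqP; apply: eq_bigr => j _; rewrite mxE.
by rewrite mulmx_free_eq0 // => /eqP/rowP/(_ i); rewrite !mxE.
Qed.

(* Off the origin, an affine hyperplane carries no affine dependence beyond
   the linear ones. *)
Lemma row_free_affinely_independent k (p : 'I_k -> 'rV[R]_n) :
  (forall i, dot (const_mx 1) (p i) = 2) -> affinely_independent p ->
  row_free (\matrix_i p i).
Proof.
move=> p2 affp; rewrite -kermx_eq0 -submx0; apply/row_subP => i.
set v := row i _.
have vA : v *m (\matrix_i p i) = 0.
  by apply/sub_kermxP; rewrite row_sub.
suff -> : v = 0 by rewrite sub0mx.
apply/rowP => j; rewrite [RHS]mxE; apply: (affp (fun j => v 0 j)).
  have : (v *m (\matrix_i p i) *m (const_mx 1 : 'rV[R]_n)^T) 0 0 = 0.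
    by rewrite vA mul0mx mxE.
  rewrite -mulmxA mxE.
  under eq_bigr do rewrite dot_mx rowK p2.
  by rewrite -mulr_suml => /eqP; rewrite mulf_eq0 pnatr_eq0 orbF => /eqP.
by rewrite -[RHS]vA mulmx_sum_row; apply: eq_bigr => l _; rewrite rowK.
Qed.

(** On the hyperplane of coordinate sum 2, which misses the origin, affine and linear independence
    agree, so affine dimension is linear rank minus one. *)
Lemma has_dim_span (S : set 'rV[R]_n) m (B : 'M[R]_(m, n)) k :
  (forall x, S x -> dot (const_mx 1) x = 2) ->
  (forall i, S (row i B)) -> (forall x, S x -> (x <= B)%MS) ->
  \rank B = k.+1 -> has_dim S k.
Proof.
move=> S2 BS SB rB; split.
  (* The rows selected by [maxrankfun] form a basis of the row space and are still points of [S]. *)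
  pose f := maxrankfun B; pose A := rowsub f B.
  have freeA : row_free A by exact: maxrowsub_free.
  exists (fun i => row (cast_ord (esym rB) i) A); split.
    by move=> i; rewrite row_rowsub.
  move=> c c0 cA i.
  have /(_ (fun i => c (cast_ord rB i))) := affinely_independent_row freeA.
  have E (T : nmodType) (F : 'I_k.+1 -> T) :
      \sum_(i < \rank B) F (cast_ord rB i) = \sum_(i < k.+1) F i.
    by rewrite (reindex (cast_ord rB)) //; exists (cast_ord (esym rB)) => j _;
       apply/val_inj.
  rewrite E => /(_ c0); under eq_bigr => j _.
    rewrite (_ : row j A = row (cast_ord (esym rB) (cast_ord rB j)) A); last first.
      by congr (row _ _); apply/val_inj.
  over.
  rewrite (E _ (fun i => c i *: row (cast_ord (esym rB) i) A)) => /(_ cA).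
  by move/(_ (cast_ord (esym rB) i)) => <-; congr c; apply/val_inj.
move=> l p Sp /(row_free_affinely_independent (fun i => S2 _ (Sp i))).
rewrite /row_free => /eqP <-; rewrite -rB; apply: mxrankS.
by apply/row_subP => i; rewrite rowK; exact: SB.
Qed.

(** A largest affinely independent family spans [S] linearly: a point outside its span could be
    appended as one more independent row. *)
Lemma span_has_dim (S : set 'rV[R]_n) k :
  (forall x, S x -> dot (const_mx 1) x = 2) -> has_dim S k ->
  exists A : 'M[R]_(k.+1, n),
    [/\ row_free A, forall i, S (row i A) & forall x, S x -> (x <= A)%MS].
Proof.
move=> S2 [[p [Sp affp]] maxk].
have freep := row_free_affinely_independent (fun i => S2 _ (Sp i)) affp.
exists (\matrix_i p i); split=> // [i|x Sx]; first by rewrite rowK.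
apply: contraT => xNp.
pose B := col_mx x (\matrix_i p i).
suff freeB : row_free B.
  suff SB : forall i, S (row i B).
    by have := maxk _ _ SB (affinely_independent_row freeB); rewrite add1n ltnn.
  move=> i; rewrite -[i]splitK.
  by case: (fintype.split i) => j /=; rewrite ?rowKu ?rowKd ?row_id ?rowK ?ord1.
rewrite /row_free -addsmxE; apply/eqP.
have /eqP rp := freep.
rewrite mxrank_disjoint_sum ?rp.
  by congr addn; rewrite rank_rV; case: eqVneq xNp => // ->; rewrite sub0mx.
(* The intersection is properly contained in the line through [x], so its rank is below 1. *)
apply/eqP; rewrite -mxrank_eq0 -leqn0 -ltnS.
rewrite (@leq_trans (\rank x)) ?rank_leq_row //.
by rewrite (ltn_leqif (mxrank_leqif_sup (capmxSl _ _))) sub_capmx submx_refl.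
Qed.

Definition edge_mx E : 'M[R]_(#|E|, n) :=
  \matrix_(l < #|E|)
    (delta_mx 0 (enum_val l).1 + delta_mx 0 (enum_val l).2 : 'rV[R]_n).

Lemma edge_mx_ker E c :
  reflect (forall p, p \in E -> c 0 p.1 + c 0 p.2 = 0)
          (edge_mx E *m c^T == 0).
Proof.
apply: (iffP eqP) => [/matrixP Ec p pE|Ec].
  have := Ec (enum_rank_in pE p) 0.
  by rewrite dot_mx rowK dot_edge enum_rankK_in // mxE.
apply/matrixP => l j; rewrite ord1 dot_mx rowK dot_edge mxE.
by apply: Ec; exact: enum_valP.
Qed.

(** Double annihilator: the columns of the cokernel matrix are functionals that vanish on the edge
    vectors, and they detect membership in the span. *)
Lemma sub_edge_mx E x :
  (forall c, (forall p, p \in E -> c 0 p.1 + c 0 p.2 = 0) -> dot c x = 0) ->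
  (x <= edge_mx E)%MS.
Proof.
move=> Ex; rewrite submxE; apply/eqP/matrixP => i j; rewrite ord1 [RHS]mxE.
pose c := (col j (cokermx (edge_mx E)))^T.
have : dot c x = 0.
  by apply: Ex; apply/edge_mx_ker; rewrite trmxK colE mulmxA mulmx_coker mul0mx.
by rewrite /c /dot mxE => {2}<-; apply: eq_bigr => l _; rewrite !mxE mulrC.
Qed.

(** Rank-nullity: the functionals vanishing on [E] form a space of dimension [n] minus the rank of
    the edge vectors. *)
Lemma rank_edge_mx E m (U : 'M[R]_(m, n)) :
  (forall c, (forall p, p \in E -> c 0 p.1 + c 0 p.2 = 0) -> (c <= U)%MS) ->
  (n <= \rank (edge_mx E) + \rank U)%N.
Proof.
move=> EU; rewrite -leq_subLR -mxrank_tr -mxrank_ker; apply: mxrankS.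
apply/row_subP => i; apply: EU; apply/edge_mx_ker/eqP/trmx_inj.
by rewrite trmx_mul trmxK trmx0; apply/sub_kermxP; exact: row_sub.
Qed.

End LinearFunctionals.

(** * Faces and facets of the edge polytope *)

Section EdgePolytope.
Context {R : realType} {n : nat}.
Variable G : graph n.
Implicit Types (c h x y : 'rV[R]_n).

Local Notation P := (edge_polytope R G).
Local Notation face h := (P `&` [set x | dot h x = 0]).

Lemma edge_in_polytope (i j : 'I_n) :
  adj G i j -> P (delta_mx 0 i + delta_mx 0 j).
Proof. by move=> ij; apply: sub_gen_smallest; exists i, j. Qed.

Lemma edge_polytope_ind (Q : set 'rV[R]_n) :
  (forall i j : 'I_n, adj G i j -> Q (delta_mx 0 i + delta_mx 0 j)) ->
  (forall x y t, 0 <= t <= 1 -> Q x -> Q y -> Q (t *: x + (1 - t) *: y)) ->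
  P `<=` Q.
Proof.
move=> QE Qconv; apply: smallest_sub => [|x [i [j [ij ->]]]]; last exact: QE.
move=> x y t; rewrite !inE => Qx Qy; apply: Qconv => //.
by rewrite ge0 le1.
Qed.

Lemma polytope_sum2 x : P x -> dot (const_mx 1) x = 2.
Proof.
move: x; apply: edge_polytope_ind => [i j _|x y t _ /= x2 y2].
  by rewrite /= dot_edge !mxE.
by rewrite dotDr !dotZr x2 y2; ring.
Qed.

Definition valid c := forall i j : 'I_n, adj G i j -> 0 <= c 0 i + c 0 j.

Definition tight c : {set 'I_n * 'I_n} :=
  [set p | adj G p.1 p.2 & c 0 p.1 + c 0 p.2 == 0]%SET.

Definition vanishes_on h (E : {set 'I_n * 'I_n}) :=
  forall p, p \in E -> h 0 p.1 + h 0 p.2 = 0.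

Definition all_edges := [set p | adj G p.1 p.2]%SET.

Lemma in_tight c i j : ((i, j) \in tight c) = adj G i j && (c 0 i + c 0 j == 0).
Proof. by rewrite inE. Qed.

Lemma tight0 : tight 0 = all_edges.
Proof. by apply/setP => p; rewrite !inE !mxE addr0 eqxx andbT. Qed.

(** Both properties pass from edge vectors to convex combinations: if two nonnegative terms add up
    to 0, each of them is 0. *)
Lemma valid_polytope c h x : valid c -> vanishes_on h (tight c) -> P x ->
  0 <= dot c x /\ (dot c x = 0 -> dot h x = 0).
Proof.
move=> vc hc; move: x; apply: edge_polytope_ind => [i j ij|x y t t01 /=].
  rewrite /= !dot_edge; split; first exact: vc.
  by move=> cij; apply: (hc (i, j)); rewrite in_tight ij cij eqxx.
move=> [cx hx] [cy hy]; rewrite !dotDr !dotZr.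
have /andP[t0 t1] := t01; rewrite -subr_ge0 in t1.
have tx := mulr_ge0 t0 cx; have ty := mulr_ge0 t1 cy.
split; first exact: addr_ge0.
move=> /eqP; rewrite paddr_eq0 // !mulf_eq0 => /andP[tx0 ty0].
have -> : t * dot h x = 0.
  by case/orP: tx0 => /eqP => [->|/hx ->]; rewrite ?mul0r ?mulr0.
by case/orP: ty0 => /eqP => [->|/hy ->]; rewrite ?mul0r ?mulr0 addr0.
Qed.

Lemma has_dim_face h k : valid h -> \rank (@edge_mx R n (tight h)) = k.+1 ->
  has_dim (face h) k.
Proof.
move=> vh rk; apply: has_dim_span rk.
- by move=> x [Px _]; exact: polytope_sum2.
- move=> i; rewrite rowK; have := enum_valP i; case: (enum_val i) => a b /=.
  rewrite in_tight => /andP[ab /eqP hab].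
  by split; [exact: edge_in_polytope|rewrite /= dot_edge].
- move=> x [Px hx]; apply: sub_edge_mx => c ch.
  by have [_ ->] := valid_polytope vh ch Px.
Qed.

Lemma has_dim_polytope k : \rank (@edge_mx R n all_edges) = k.+1 ->
  has_dim P k.
Proof.
rewrite -tight0 => rk; have : has_dim (face 0) k.
  by apply: has_dim_face rk => i j _; rewrite !mxE addr0.
congr has_dim; apply/seteqP; split=> x; first by case.
by move=> Px; split=> //=; rewrite dot0l.
Qed.

(** Bounds the number of vertices by the dimension; [U] will be zero for a non-bipartite graph and a
    single row for a bipartite one. *)
Lemma has_dim_leq k m (U : 'M[R]_(m, n)) : has_dim P k ->
  (forall c, vanishes_on c all_edges -> (c <= U)%MS) ->
  (n <= k.+1 + \rank U)%N.
Proof.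
move=> /(span_has_dim polytope_sum2)[A [freeA _ PA]] /rank_edge_mx.
move=> /leq_trans; apply; rewrite leq_add2r.
have /eqP <- := freeA; apply: mxrankS; apply/row_subP => i; rewrite rowK.
apply: PA; have := enum_valP i; case: (enum_val i) => a b /=.
by rewrite inE; exact: edge_in_polytope.
Qed.

Lemma has_dim_trivial_ker k : n = k.+1 ->
  (forall c, vanishes_on c all_edges -> c = 0) -> has_dim P k.
Proof.
move=> nk ker0; apply: has_dim_polytope; apply/eqP.
rewrite eqn_leq -{1}nk rank_leq_col /=.
rewrite -nk; have := @rank_edge_mx R n all_edges 0 0; rewrite mxrank0 addn0.
by apply=> c /ker0 ->; rewrite sub0mx.
Qed.

(** If the functionals vanishing on the tight edges form the line of [h], the tight edge vectors
    have rank [n - 1], one less than all edge vectors. *)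
Lemma facet_criterion h k : n = k.+2 -> valid h -> h != 0 ->
  (forall c, vanishes_on c all_edges -> c = 0) ->
  (forall c, vanishes_on c (tight h) -> (c <= h)%MS) ->
  is_facet P (face h).
Proof.
move=> nk vh h0 ker0 kerh; split.
  (* [is_face] asks for an upper bound, hence the sign change. *)
  exists (- h), 0; rewrite -scaleN1r; split=> [x Px|].
    rewrite -[X in X <= _]/(dot _ x) dotZl mulN1r oppr_le0.
    have [|//] := @valid_polytope h 0 x vh _ Px.
    by move=> p _; rewrite !mxE addr0.
  congr (_ `&` _); apply/seteqP; split => x /=;
      rewrite -[X in X = _ -> _]/(dot _ x) -[X in _ -> X = _]/(dot _ x) dotZl
              mulN1r.
    by move=> ->; rewrite oppr0.
  by move=> /eqP; rewrite oppr_eq0 => /eqP.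
exists k; split; first exact: has_dim_trivial_ker.
(* The rank is at most [n - 1] because [h] itself kills the tight edges, and at least [n - 1] by
   [kerh]. *)
apply: has_dim_face => //; apply/eqP; rewrite eqn_leq; apply/andP; split.
  have : (edge_mx (tight h) <= kermx h^T)%MS.
    by apply/sub_kermxP/eqP/edge_mx_ker => p; rewrite inE => /andP[_ /eqP].
  by move=> /mxrankS; rewrite mxrank_ker mxrank_tr rank_rV h0; lia.
by have := rank_edge_mx kerh; rewrite rank_rV h0; lia.
Qed.

(** The span of a facet has codimension one in the span of the polytope. Any functional that is zero
    on the facet but not on the whole polytope therefore has the same kernel there. *)
Lemma facet_functional F : is_facet P F -> exists c,
  [/\ valid c, ~ vanishes_on c all_edges &
     forall h, vanishes_on h (tight c) -> ~ vanishes_on h all_edges ->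
       F = face h].
Proof.
move=> [[c' [b [c'b FE]]] [k [dimP dimF]]].
(* Coordinates of points of the polytope add up to 2, so the constant [b] is itself a linear
   functional there and the inequality becomes homogeneous. *)
pose c : 'rV[R]_n := const_mx (b / 2) - c'.
have cE x : P x -> dot c x = b - dot c' x.
  move=> Px; rewrite dotDl -scaleN1r dotZl mulN1r; congr (_ - _).
  rewrite -[RHS](@mulfVK _ 2) ?pnatr_eq0 // -(polytope_sum2 Px) -dotZl.
  by congr dot; apply/rowP => i; rewrite !mxE mulr1.
have vc : valid c.
  move=> i j ij; rewrite -dot_edge cE ?subr_ge0; last exact: edge_in_polytope.
  by apply: c'b; exact: edge_in_polytope.
have {}FE : F = face c.
  rewrite FE; apply/seteqP; split=> x [Px /= Ex]; split=> //=.
    by rewrite cE // /dot Ex subrr.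
  by move: Ex; rewrite cE // => /eqP; rewrite subr_eq0 => /eqP/esym.
have F2 x : F x -> dot (const_mx 1) x = 2.
  by rewrite FE => -[Px _]; exact: polytope_sum2.
have [A [/eqP rA FA AF]] := span_has_dim F2 dimF.
have [B [/eqP rB PB BP]] := span_has_dim polytope_sum2 dimP.
have allv h : vanishes_on h all_edges -> forall x, P x -> dot h x = 0.
  rewrite -tight0 => h0 x Px.
  have v0 : valid 0 by move=> i j _; rewrite !mxE addr0.
  by have [_ -> //] := valid_polytope v0 h0 Px; rewrite dot0l.
have sub_face h x :
    (forall y, F y -> dot h y = 0) -> ~ vanishes_on h all_edges ->
    face h x -> (x <= A)%MS.
  move=> hF hN [Px hx]; have AB : (A <= B)%MS.
    by apply/row_subP => i; apply: BP; have := FA i; rewrite FE; case.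
  (* The space [B :&: kermx h^T] lies strictly below [B] and contains [A], whose rank is only one
     less than that of [B]; hence it equals [A]. *)
  have hV : (B :&: kermx h^T < B)%MS.
    rewrite ltmxE capmxSl /= sub_capmx submx_refl /=; apply/negP => Bh.
    apply: hN => -[i j]; rewrite inE /= => ij; rewrite -dot_edge.
    have := submx_trans (BP _ (edge_in_polytope ij)) Bh.
    by move=> /sub_kermxP/matrixP/(_ 0 0); rewrite dot_mx row_id mxE.
  have AV : (A <= B :&: kermx h^T)%MS.
    by rewrite sub_capmx AB sub_ker_dot // => i; exact: hF.
  have VA : (B :&: kermx h^T <= A)%MS.
    rewrite -(geq_leqif (mxrank_leqif_sup AV)).
    by have := rank_ltmx hV; rewrite rB rA.
  apply: submx_trans VA; rewrite sub_capmx BP //= sub_ker_dot // => i.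
  by rewrite row_id.
(* Otherwise the facet would be the whole polytope, against the dimensions. *)
have cN : ~ vanishes_on c all_edges.
  move=> /allv c0; have : (B <= A)%MS.
    by apply/row_subP => i; apply: AF; rewrite FE; split; [exact: PB|exact: c0].
  by move=> /mxrankS; rewrite rA rB ltnn.
exists c; split=> // h hc hN.
have hF x : F x -> dot h x = 0.
  by rewrite FE => -[Px /= cx]; have [_ ->] := valid_polytope vc hc Px.
apply/seteqP; split=> [x Fx|x Hx].
  by split=> /=; [move: Fx; rewrite FE; case|exact: hF].
have := sub_face _ _ hF hN Hx; case: Hx => Px _ xA; rewrite FE; split=> //=.
apply: dot_sub xA => i; have := FA i; rewrite FE; case => //.
Qed.

End EdgePolytope.

(** * Counting sets through finite types *)

Section FiniteCardinality.

Lemma card_set_finType (T : finType) (A : {set T}) : [set` A] #= `I_#|A|.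
Proof.
rewrite (card_eqr card_II).
have -> : [set` A] = @enum_val T (mem A) @` [set: 'I_#|A|].
  apply/seteqP; split=> [x /= xA|_ /= [i _ <-]]; last exact: enum_valP.
  by exists (enum_rank_in xA x); rewrite // enum_rankK_in.
by apply: inj_card_eq => i j _ _; exact: enum_val_inj.
Qed.

(** Besides the bound, this gives finiteness, so that a number of facets exists at all. *)
Lemma card_finite_cover (T : finType) (A : {set T}) (U : Type) (f : T -> U)
    (S : set U) :
  (forall u, S u -> exists2 x, x \in A & f x = u) ->
  exists2 m, S #= `I_m & (m <= #|A|)%N.
Proof.
move=> SA.
have SI : S #<= `I_#|A|.
  rewrite -(card_le_eqr (card_set_finType A)).
  apply: card_le_trans (card_image_le f _).
  apply: subset_card_le => u /SA[x xA <-].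
  by exists x.
have /finite_setP[m Sm] : finite_set S by apply/finite_set_leP; exists #|A|.
by exists m => //; rewrite -card_le_II -(card_le_eql Sm).
Qed.

Lemma card_finite_inj (T : finType) (U : Type) (f : T -> U) (S : set U) m :
  injective f -> (forall x, S (f x)) -> S #= `I_m -> (#|T| <= m)%N.
Proof.
move=> injf Sf Sm; rewrite -card_le_II -(card_le_eqr Sm) -cardsT.
rewrite -(card_le_eql (card_set_finType _)).
rewrite -(card_le_eql (inj_card_eq (f := f) _)); last by move=> x y _ _ /injf.
by apply: subset_card_le => _ [x _ <-].
Qed.

End FiniteCardinality.

(** * Classification of facets and the upper bound *)

Section UpperBound.
Context {R : realType} {n : nat}.
Variable G : graph n.
Hypothesis conG : connected_graph G.
Implicit Types (c h x y : 'rV[R]_n) (B T : {set 'I_n}).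

Local Notation P := (edge_polytope R G).
Local Notation face h := (P `&` [set x | dot h x = 0]).

Lemma connected_const (X : Type) (f : 'I_n -> X) :
  (forall i j : 'I_n, adj G i j -> f i = f j) -> forall i j, f i = f j.
Proof.
move=> fE i j; have /connectP[p pG ->] := conG.2 i j.
by elim: p i pG => //= k p IHp i /andP[/fE -> /IHp].
Qed.

Definition bipartition B :=
  forall i j : 'I_n, adj G i j -> (i \in B) != (j \in B).

Definition independent T := [forall i in T, forall j in T, ~~ adj G i j].

Definition nbr T := [set j | [exists i in T, adj G i j]]%SET.

Definition side_sign B : 'rV[R]_n := \row_i (-1) ^+ (i \in B).

Definition nbr_diff T : 'rV[R]_n := \row_j ((j \in nbr T)%:R - (j \in T)%:R).

Lemma vanishes_all c : vanishes_on c (all_edges G) ->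
  forall i j : 'I_n, adj G i j -> c 0 i = - c 0 j.
Proof.
move=> cG i j ij; apply/eqP; rewrite -addr_eq0; apply/eqP.
by apply: (cG (i, j)); rewrite inE.
Qed.

(** Such a [c] changes sign along each edge, so its square is constant; were it nonzero, the set of
    positive coordinates would be a bipartition. *)
Lemma ker_nonbipartite c : ~ (exists B, bipartition B) ->
  vanishes_on c (all_edges G) -> c = 0.
Proof.
move=> nb /vanishes_all cG; apply/rowP => i; rewrite mxE; apply/eqP.
apply: contra_notT nb => ci0; exists [set j | 0 < c 0 j]%SET => j k jk.
have ck0 : c 0 k != 0.
  rewrite -sqrf_eq0 (@connected_const _ (fun j => c 0 j ^+ 2) _ k i).
    by rewrite sqrf_eq0.
  by move=> a b /cG ->; rewrite sqrrN.
rewrite !inE (cG _ _ jk) oppr_gt0.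
by case: ltgtP ck0.
Qed.

(** Multiplying by the signs of the two sides turns a function alternating along edges into a
    constant one. *)
Lemma ker_bipartite c B : bipartition B -> vanishes_on c (all_edges G) ->
  exists a, c = a *: side_sign B.
Proof.
move=> bipB /vanishes_all cG.
have [n0 _] := conG; pose i0 := Ordinal n0.
exists (c 0 i0 * (-1) ^+ (i0 \in B)); apply/rowP => i.
rewrite !mxE (@connected_const _ (fun j => c 0 j * (-1) ^+ (j \in B)) _ i0 i).
  by rewrite -mulrA -signr_addb addbb mulr1.
move=> j k jk; rewrite (cG _ _ jk); have := bipB _ _ jk.
by case: (j \in B); case: (k \in B); rewrite // ?expr1 ?expr0 => _; ring.
Qed.

Lemma nbr_diff_neq0 T i : i \in T -> i \notin nbr T -> nbr_diff T != 0.
Proof.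
move=> iT iN; apply/eqP => /rowP/(_ i); rewrite !mxE iT (negbTE iN).
by move/eqP; rewrite sub0r oppr_eq0 oner_eq0.
Qed.

(** When [c >= 0], both ends of a tight edge have coordinate 0. So x_i vanishes on the tight edges
    as soon as [c] is positive at [i], but not on all edges, since [i] is not isolated. *)
Lemma facet_coordinate c F : valid G c -> ~ vanishes_on c (all_edges G) ->
  (forall h, vanishes_on h (tight G c) -> ~ vanishes_on h (all_edges G) ->
     F = face h) ->
  (forall i, 0 <= c 0 i) -> exists i, F = face (delta_mx 0 i).
Proof.
move=> vc cN Fh c_ge0.
have [i ci] : exists i, 0 < c 0 i.
  apply: contra_notP cN => cle [a b] _ /=.
  have c0 i : c 0 i = 0.
    apply/eqP; rewrite eq_le c_ge0 andbT leNgt; apply/negP => ci.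
    by apply: cle; exists i.
  by rewrite !c0 addr0.
exists i; apply: Fh => [[a b]|].
  rewrite in_tight paddr_eq0 // => /and3P[_ /eqP ca /eqP cb].
  rewrite !mxE /= !(eq_sym _ i); case: eqVneq ca ci => [->->|_ _]; rewrite ?ltxx //.
  by case: eqVneq cb => [->->|_ _ _]; rewrite ?ltxx ?addr0.
have [j ij] := adj_no_isolated G i.
move=> /(_ (i, j)); rewrite inE ij !mxE !eqxx /= => /(_ isT)/eqP.
by rewrite -natrD pnatr_eq0.
Qed.

(* The set of minimisers of [c] replaces [c] by a functional with
   coefficients 0, 1, -1 that is still zero on the tight edges. *)
Lemma negative_minimisers c i : valid G c -> c 0 i < 0 ->
  exists T, [/\ T != finset.set0, vanishes_on (nbr_diff T) (tight G c),
    forall j, j \in T -> c 0 j < 0 & forall j, j \in nbr T -> 0 < c 0 j].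
Proof.
move=> vc ci.
pose m := [arg min_(j < i) c 0 j]%O.
have cm j : c 0 m <= c 0 j.
  by rewrite /m; case: arg_minP => // a _; apply.
have cm0 : c 0 m < 0 by exact: le_lt_trans (cm i) ci.
pose T := [set j | c 0 j == c 0 m]%SET.
have nbrT j : j \in nbr T -> - c 0 m <= c 0 j.
  rewrite inE => /existsP[a /andP[]]; rewrite inE => /eqP <- aj.
  by rewrite -subr_ge0 opprK addrC; exact: vc.
exists T; split.
- by apply/set0Pn; exists m; rewrite inE.
(* On a tight edge one end lies in N(T) exactly when the other lies in T, so the contributions of
   the two ends cancel. *)
- have nT a b : adj G a b -> c 0 a + c 0 b = 0 -> (a \in nbr T) = (b \in T).
    move=> ab cab; apply/idP/idP => [/nbrT|bT].
      rewrite inE eq_le cm andbT; move: cab => /eqP; rewrite addr_eq0 => /eqP ->.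
      by rewrite lerN2.
    by rewrite inE; apply/existsP; exists b; rewrite bT adj_sym.
  move=> [a b]; rewrite in_tight => /andP[ab /eqP cab] /=.
  rewrite !mxE (nT a b) // (nT b a) 1?adj_sym 1?addrC //.
  by rewrite addrC addrA subrK subrr.
- by move=> j; rewrite inE => /eqP ->.
- by move=> j /nbrT; apply: lt_le_trans; rewrite oppr_gt0.
Qed.

(** An edge inside the set T of minimisers would get a negative value, so T is independent. *)
Lemma facet_nonbipartite F : ~ (exists B, bipartition B) -> is_facet P F ->
  (exists i, F = face (delta_mx 0 i)) \/
  (exists T, [/\ T != finset.set0, independent T & F = face (nbr_diff T)]).
Proof.
move=> nb /facet_functional[c [vc cN Fh]].
have [c_ge0|] := pselect (forall i, 0 <= c 0 i).
  by left; exact: facet_coordinate Fh c_ge0.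
move=> /existsNP[i /negP]; rewrite -ltNge => /(negative_minimisers vc).
move=> [T [T0 hT cT cN']]; right; exists T; split=> //.
  apply/forall_inP => a aT; apply/forall_inP => b bT.
  by apply/negP => /vc; have := cT _ aT; have := cT _ bT; lra.
apply: Fh => // /(ker_nonbipartite nb)/eqP; apply/negP.
have [a aT] := set0Pn _ T0; apply: (nbr_diff_neq0 aT).
by apply/negP => /cN'; rewrite ltNge ltW // cT.
Qed.

Lemma facet_bipartite F B : bipartition B -> is_facet P F ->
  (exists i, F = face (delta_mx 0 i)) \/
  (exists T, [/\ T != finset.set0, T \subset B & F = face (nbr_diff T)]).
Proof.
move=> bipB /facet_functional[c' [vc' c'N Fh']].
have [n0 _] := conG; pose i0 := Ordinal n0.
have [k0 k0B] : exists k, k \notin B.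
  have [j ij] := adj_no_isolated G i0.
  by case: (boolP (i0 \in B)) (bipB _ _ ij) => iB; [exists j|exists i0].
(* Shifting by the least value off [B] makes the functional nonnegative there and zero at [k]; its
   negative minimisers then lie in [B]. *)
pose k := [arg min_(j < k0 | j \notin B) c' 0 j]%O.
have [kB ck] : k \notin B /\ forall j, j \notin B -> c' 0 k <= c' 0 j.
  by rewrite /k; case: arg_minP.
(* Adding a multiple of [side_sign B] changes no value on an edge. *)
pose c := c' - c' 0 k *: side_sign B.
have cE i j : adj G i j -> c 0 i + c 0 j = c' 0 i + c' 0 j.
  move=> /bipB; rewrite !mxE.
  by case: (i \in B); case: (j \in B); rewrite // ?expr1 ?expr0 => _; ring.
have cB j : j \notin B -> 0 <= c 0 j.
  by move=> jB; rewrite !mxE (negbTE jB) mulr1 subr_ge0 ck.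
have ck0 : c 0 k = 0 by rewrite !mxE (negbTE kB) mulr1 subrr.
have vc : valid G c by move=> i j ij; rewrite cE // vc'.
have cN : ~ vanishes_on c (all_edges G).
  by move=> cG; apply: c'N => -[i j] ij; rewrite -cE ?cG //; rewrite inE in ij.
have tE : tight G c = tight G c'.
  apply/setP => -[i j]; rewrite !in_tight.
  by case: (boolP (adj G i j)) => //= ij; rewrite cE.
rewrite -tE in Fh'.
have [c_ge0|] := pselect (forall i, 0 <= c 0 i).
  by left; exact: facet_coordinate Fh' c_ge0.
move=> /existsNP[i /negP]; rewrite -ltNge => /(negative_minimisers vc).
move=> [T [T0 hT cT cN']]; right; exists T; split=> //.
  by apply/fintype.subsetP => a /cT; apply: contraTT => /cB; rewrite leNgt.
apply: Fh' => // /(ker_bipartite bipB)[a Ta].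
have [t tT] := set0Pn _ T0.
have tN : t \notin nbr T by apply/negP => /cN'; rewrite ltNge ltW // cT.
have /eqP := nbr_diff_neq0 tT tN; apply; rewrite Ta.
(* The zero coordinate at [k] puts [k] outside both T and N(T), which forces the multiple [a] of
   [side_sign B] to be 0. *)
have : nbr_diff T 0 k = 0.
  have kT : k \notin T by apply/negP => /cT; rewrite ck0 ltxx.
  have kN : k \notin nbr T by apply/negP => /cN'; rewrite ck0 ltxx.
  by rewrite mxE (negbTE kT) (negbTE kN) subrr.
by rewrite Ta !mxE (negbTE kB) mulr1 => ->; rewrite scale0r.
Qed.

(** If T and its complement were both independent, T would be a bipartition. Hence the independent
    sets and their complements form two disjoint families of equal size. *)
Lemma card_independent : ~ (exists B, bipartition B) ->
  (#|[set T | independent T]%SET| * 2 <= 2 ^ n)%N.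
Proof.
move=> nb; set I := [set T | _]%SET.
have <- : #|{set 'I_n}| = (2 ^ n)%N 
  by rewrite -cardsT -powersetT card_powerset cardsT card_ord.
have IC : I :&: (@finset.setC 'I_n @: I) = finset.set0.
  apply/setP => T; rewrite finset.in_setI finset.in_set0.
  apply/negP => /andP[TI /imsetP[T' T'I TE]].
  apply: nb; exists T => i j ij.
  move: TI T'I; rewrite !inE => /forall_inP TI /forall_inP T'I.
  case: (boolP (i \in T)) (boolP (j \in T)) => iT [] jT //.
    by have /forall_inP/(_ _ jT) := TI _ iT; rewrite ij.
  rewrite TE !inE !negbK in iT jT.
  by have /forall_inP/(_ _ jT) := T'I _ iT; rewrite ij.
rewrite muln2 -addnn -{2}(card_imset (mem I) (inv_inj (@finset.setCK _))).
by rewrite -cardsUI IC cards0 addn0 max_card.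
Qed.

Lemma count_facets (S : {set {set 'I_n}}) :
  (forall F, is_facet P F -> (exists i, F = face (delta_mx 0 i)) \/
     (exists T, T \in S /\ F = face (nbr_diff T))) ->
  exists2 m, has_facets R G m & (m <= n + #|S|)%N.
Proof.
move=> FS.
pose f (u : 'I_n + {set 'I_n}) :=
  match u with inl i => face (delta_mx 0 i) | inr T => face (nbr_diff T) end.
pose A := ([set inl i | i in 'I_n] :|: [set inr T | T in S])%SET.
have [m Fm mA] : exists2 m, has_facets R G m & (m <= #|A|)%N.
  apply: (@card_finite_cover _ A _ f) => F /FS[[i ->]|[T [TS ->]]].
    by exists (inl i) => //=; rewrite inE imset_f.
  by exists (inr T) => //=; rewrite inE [X in _ || X]imset_f ?orbT.
exists m => //; apply: leq_trans mA _; apply: leq_trans (leq_card_setU _ _) _.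
by apply: leq_add; apply: leq_trans (leq_imset_card _ _) _; rewrite ?card_ord.
Qed.

Lemma facets_upper_bound d : (3 <= d)%N -> has_dim P d ->
  exists2 m, has_facets R G m & (m <= 2 ^ d + d)%N.
Proof.
move=> d3 dimP.
have [[B0 bip0]|nb] := pselect (exists B, bipartition B).
- have [B bipB Bn] : exists2 B, bipartition B & (#|B| * 2 <= n)%N.
    have := cardsC B0; rewrite card_ord => BC.
    case: (leqP (#|B0| * 2) n) => [?|B0n]; first by exists B0.
    exists (~: B0)%SET; last by lia.
    by move=> i j /bip0; rewrite !inE; case: (i \in _); case: (j \in _).
  have nd : (n <= d.+2)%N.
    apply: leq_trans (has_dim_leq (U := side_sign B) dimP _) _.
      by move=> c /(ker_bipartite bipB)[a ->]; exact: scalemx_sub.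
    by have := rank_leq_row (side_sign B); lia.
  have [F /(facet_bipartite bipB)[|[T [T0 TB ->]]]|m Fm mS] :=
      @count_facets (powerset B :\ finset.set0)%SET; first by left.
    by right; exists T; rewrite !inE T0.
  exists m => //; apply: leq_trans mS _.
  have := cardsD1 finset.set0 (powerset B).
  rewrite card_powerset powersetE finset.sub0set add1n => cB.
  (* From [2 * #|B| <= n <= d + 2] and [d >= 3] follows [#|B| <= d - 1]; the total is then at most
     [d + 1 + 2 ^ (d - 1)]. *)
  have : (2 ^ #|B| <= 2 ^ d.-1)%N by rewrite leq_exp2l //; lia.
  have : (0 < 2 ^ d.-1)%N by rewrite expn_gt0.
  have : (2 ^ d = 2 * 2 ^ d.-1)%N by rewrite -expnS prednK //; lia.
  move: nd cB; move: #|_ :\ _| (2 ^ #|B|)%N (2 ^ d)%N (2 ^ d.-1)%N.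
  by clear=> *; lia.
- have nd : (n <= d.+1)%N.
    have := has_dim_leq (U := (0 : 'M[R]_(0, n))) dimP; rewrite mxrank0 addn0.
    by apply=> c /(ker_nonbipartite nb) ->; exact: sub0mx.
  have [F /(facet_nonbipartite nb)[|[T [T0 TI ->]]]|m Fm mS] :=
      @count_facets ([set T | independent T] :\ finset.set0)%SET; first by left.
    by right; exists T; rewrite !inE T0.
  exists m => //; apply: leq_trans mS _.
  have := cardsD1 finset.set0 [set T | independent T]%SET.
  (* Excluding the empty set is what makes the bound exact: [(d + 1) + (2 ^ d - 1) = 2 ^ d + d]. *)
  have -> : finset.set0 \in [set T | independent T]%SET.
    by rewrite inE; apply/forallP => i; rewrite inE.
  have := card_independent nb.
  have : (2 ^ n <= 2 ^ d.+1)%N by rewrite leq_exp2l.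
  rewrite expnS add1n; move: nd; move: #|_ :\ _| #|_| (2 ^ n)%N (2 ^ d)%N.
  by clear=> *; lia.
Qed.

End UpperBound.

(** * The windmill graph and the lower bound *)

Section Windmill.
Variables k r : nat.

(* The apex [None] is joined to every vertex of k disjoint triangles and to r
   pendant vertices. *)
Local Notation windmill_vertex := (option ('I_k * 'I_3 + 'I_r)).

Definition windmill_adj : rel windmill_vertex := fun x y =>
  match x, y with
  | Some u, Some v =>
      if (u, v) is (inl p, inl q) then (p.1 == q.1) && (p.2 != q.2) else false
  | None, None => false
  | _, _ => true
  end.

Local Notation N := #|{: windmill_vertex}|.

Lemma card_windmill : N = (3 * k + r).+1.
Proof. by rewrite card_option card_sum card_prod !card_ord mulnC. Qed.

Definition windmill_rel : rel 'I_N :=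
  fun i j => windmill_adj (enum_val i) (enum_val j).

Lemma windmill_relE x y :
  windmill_rel (enum_rank x) (enum_rank y) = windmill_adj x y.
Proof. by rewrite /windmill_rel !enum_rankK. Qed.

Lemma windmill_sym : symmetric windmill_rel.
Proof.
move=> i j; rewrite /windmill_rel.
case: (enum_val i) (enum_val j) => [[[b t]|w]|] [[[b' t']|w']|] //=.
by rewrite eq_sym [t == _]eq_sym.
Qed.

Lemma windmill_irrefl : irreflexive windmill_rel.
Proof.
move=> i; rewrite /windmill_rel.
by case: (enum_val i) => [[[b t]|w]|] //=; rewrite !eqxx.
Qed.

Hypothesis k_gt0 : (0 < k)%N.

Lemma windmill_no_isolated i : exists j, windmill_rel i j.
Proof.
rewrite -[i]enum_valK; case: (enum_val i) => [u|].
  by exists (enum_rank None); rewrite windmill_relE.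
exists (enum_rank (Some (inl (Ordinal k_gt0, ord0)) : windmill_vertex)).
by rewrite windmill_relE.
Qed.

Definition windmill : graph N :=
  Graph windmill_sym windmill_irrefl windmill_no_isolated.

Lemma windmill_connected : connected_graph windmill.
Proof.
split=> [|i j]; first by rewrite card_windmill.
have conN i' : connect windmill_rel (enum_rank None) i'.
  rewrite -[i']enum_valK; case: (enum_val i') => [u|]; last exact: connect0.
  by apply: connect1; rewrite windmill_relE.
by apply: connect_trans (conN j); rewrite (sym_connect_sym windmill_sym) conN.
Qed.

Section Functionals.
Variable R : realType.
Implicit Types (c h : 'rV[R]_N) (s : {ffun 'I_k -> option 'I_3}).

Local Notation coord c x := (c 0 (enum_rank (x : windmill_vertex))).
Local Notation apex := (None : windmill_vertex).
Local Notation tri b t := (Some (inl (b, t)) : windmill_vertex).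
Local Notation pendant w := (Some (inr w) : windmill_vertex).

Definition windmill_fun (f : windmill_vertex -> R) : 'rV[R]_N :=
  \row_i f (enum_val i).

Lemma windmill_funE f x : coord (windmill_fun f) x = f x.
Proof. by rewrite mxE enum_rankK. Qed.

Lemma windmill_vec_eq c c' : (forall x, coord c x = coord c' x) -> c = c'.
Proof. by move=> cc; apply/rowP => i; rewrite -[i]enum_valK. Qed.

Lemma windmill_vanishes c h : vanishes_on c (tight windmill h) ->
  forall x y, windmill_adj x y -> coord h x + coord h y = 0 ->
  coord c x + coord c y = 0.
Proof.
move=> cv x y xy hxy; apply: (cv (enum_rank x, enum_rank y)).
by rewrite in_tight /= windmill_relE xy hxy eqxx.
Qed.

Lemma windmill_valid f :
  (forall x y, windmill_adj x y -> 0 <= f x + f y) ->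
  valid windmill (windmill_fun f).
Proof.
move=> fE i j; rewrite -[i]enum_valK -[j]enum_valK /= windmill_relE.
by rewrite !windmill_funE; exact: fE.
Qed.

(** Adding the two edges at [t] and subtracting the third leaves twice [a t]. *)
Lemma triangle_vanishes (a : 'I_3 -> R) :
  (forall t t', t != t' -> a t + a t' = 0) -> forall t, a t = 0.
Proof.
move=> aE t; pose t1 : 'I_3 := ordS t; pose t2 : 'I_3 := ordS t1.
have := aE t t1; have := aE t1 t2; have := aE t t2.
case: t @t1 @t2 => [[|[|[|//]]]] ? /= => /(_ isT) ? /(_ isT) ? /(_ isT) ?; lra.
Qed.

(** This is [nbr_diff] of the set T of all pendant vertices and the triangle vertices picked by [s];
    if T is empty, it is the coordinate of the apex. *)
Definition chosen s (x : windmill_vertex) : R :=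
  match x with
  | None => 1
  | Some (inr _) => -1
  | Some (inl (b, t)) =>
      if s b is Some t0 then (if t == t0 then -1 else 1) else 0
  end.

Lemma chosen_valid s : valid windmill (windmill_fun (chosen s)).
Proof.
apply: windmill_valid => -[[[b t]|w]|] [[[b' t']|w']|] //=; try lra.
- case/andP => /eqP <-; case: (s b) => [t0|]; last by lra.
  by case: (eqVneq t t0) => [->|_]; case: (eqVneq t' t0) => _ // _; lra.
- by move=> _; case: (s b) => [t0|]; [case: eqP => _|]; lra.
- by move=> _; case: (s b') => [t0|]; [case: eqP => _|]; lra.
Qed.

(** Values propagate from the apex along tight edges; a triangle without a chosen vertex has three
    tight sides, so its values are 0. *)
Lemma chosen_ker s c : vanishes_on c (tight windmill (windmill_fun (chosen s))) ->
  c = coord c apex *: windmill_fun (chosen s).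
Proof.
move=> /windmill_vanishes cv; apply: windmill_vec_eq => x.
rewrite mxE windmill_funE.
have {}cv y z : windmill_adj y z -> chosen s y + chosen s z = 0 ->
    coord c y = - coord c z.
  by move=> yz hyz; apply/eqP; rewrite -addr_eq0 cv ?windmill_funE.
case: x => [[[b t]|w]|] /=; last by rewrite mulr1.
  case sb : (s b) => [t0|].
    have ct0 : coord c (tri b t0) = - coord c apex.
      by apply: cv => //=; rewrite sb eqxx addNr.
    case: eqVneq => [->|tt0]; first by rewrite ct0 mulrN1.
    rewrite (cv _ (tri b t0)) ?ct0 ?opprK ?mulr1 //= ?eqxx ?tt0 //.
    by rewrite sb eqxx (negbTE tt0) subrr.
  rewrite mulr0; apply: (@triangle_vanishes (fun t => coord c (tri b t))) => u u' uu'.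
  by rewrite (cv _ (tri b u')) ?addNr //= ?eqxx ?uu' // sb addr0.
by rewrite (cv _ apex) ?mulrN1 //= addNr.
Qed.

Lemma windmill_ker c : vanishes_on c (all_edges windmill) -> c = 0.
Proof.
rewrite -(tight0 (R := R)) => /windmill_vanishes cv; apply: windmill_vec_eq => x.
have {}cv y z : windmill_adj y z -> coord c y + coord c z = 0.
  by move=> yz; apply: cv yz _; rewrite !mxE addr0.
have ct b t : coord c (tri b t) = 0.
  apply: (@triangle_vanishes (fun t => coord c (tri b t))) => u u' uu'.
  by apply: cv; rewrite /= eqxx.
have ca : coord c apex = 0.
  by have := cv apex (tri (Ordinal k_gt0) ord0) isT; rewrite ct addr0.
rewrite [RHS]mxE; case: x => [[[b t]|w]|] //.
by have := cv (pendant w) apex isT; rewrite ca addr0.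
Qed.

Definition corner : windmill_vertex := tri (Ordinal k_gt0) ord0.

Lemma corner_ker c :
  vanishes_on c (tight windmill (windmill_fun (fun x => (x == corner)%:R))) ->
  c = coord c corner *: windmill_fun (fun x => (x == corner)%:R).
Proof.
move=> /windmill_vanishes cv.
have {}cv y z : windmill_adj y z -> y != corner -> z != corner ->
    coord c y + coord c z = 0.
  move=> yz yc zc; apply: cv yz _.
  by rewrite !windmill_funE (negbTE yc) (negbTE zc) addr0.
set b0 := Ordinal k_gt0.
pose t1 : 'I_3 := inord 1; pose t2 : 'I_3 := inord 2.
have nc t : t != ord0 -> tri b0 t != corner.
  by apply: contra_neq => -[].
have t10 : t1 != ord0 by rewrite -val_eqE /= inordK.
have t20 : t2 != ord0 by rewrite -val_eqE /= inordK.
have t12 : t1 != t2 by rewrite -val_eqE /= !inordK.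
(* The apex and the other two vertices of the corner's triangle again form a triangle, whose edges
   are all tight. *)
have ca : coord c apex = 0.
  have := cv apex (tri b0 t1) isT isT (nc _ t10).
  have := cv apex (tri b0 t2) isT isT (nc _ t20).
  have adj12 : windmill_adj (tri b0 t1) (tri b0 t2) by rewrite /= ?eqxx t12.
  have := cv _ _ adj12 (nc _ t10) (nc _ t20).
  by move=> *; lra.
apply: windmill_vec_eq => x; rewrite mxE windmill_funE.
case: (eqVneq x corner) => [->|xc]; first by rewrite mulr1.
rewrite mulr0; case: x xc => [u|//] xc.
by have := cv (Some u) apex isT xc isT; rewrite ca addr0.
Qed.

(** The extra value [None] supplies the one facet beyond [4 ^ k] that makes the lower bound
    strict. *)
Definition windmill_form (u : option {ffun 'I_k -> option 'I_3}) : 'rV[R]_N :=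
  if u is Some s then windmill_fun (chosen s)
  else windmill_fun (fun x => (x == corner)%:R).

(** A vertex where the form takes the value 1, which fixes its scaling. *)
Definition base_vertex (u : option {ffun 'I_k -> option 'I_3}) :=
  if u is Some _ then apex else corner.

Lemma base_vertexE u : coord (windmill_form u) (base_vertex u) = 1.
Proof. by case: u => [s|]; rewrite windmill_funE //= eqxx. Qed.

Lemma windmill_form_ker u c : vanishes_on c (tight windmill (windmill_form u)) ->
  c = coord c (base_vertex u) *: windmill_form u.
Proof. by case: u => [s|]; [exact: chosen_ker|exact: corner_ker]. Qed.

Definition windmill_face u : set 'rV[R]_N :=
  edge_polytope R windmill `&` [set x | dot (windmill_form u) x = 0].

Lemma windmill_facet u :
  is_facet (edge_polytope R windmill) (windmill_face u).
Proof.
apply: (@facet_criterion _ _ windmill _ (3 * k + r).-1).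
- by rewrite card_windmill prednK // addn_gt0 muln_gt0 k_gt0.
- case: u => [s|]; first exact: chosen_valid.
  by apply: windmill_valid => x y _; rewrite addr_ge0.
- apply/eqP => u0; have := base_vertexE u.
  by rewrite u0 mxE => /eqP; rewrite eq_sym oner_eq0.
- exact: windmill_ker.
- by move=> c /windmill_form_ker ->; exact: scalemx_sub.
Qed.

Lemma chosen_inj s s' : chosen s =1 chosen s' -> s = s'.
Proof.
move=> ss'; apply/ffunP => b.
case sb: (s b) => [t|].
  have := ss' (tri b t); rewrite /= sb eqxx.
  case: (s' b) => [t'|] /eqP; last by rewrite oppr_eq0 oner_eq0.
  by case: (eqVneq t t') => [->//|_]; rewrite eq_sym -addr_eq0 (pnatr_eq0 _ 2).
case sb': (s' b) => [t|] //.
have /eqP := ss' (tri b t); rewrite /= sb sb' eqxx.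
by rewrite eq_sym oppr_eq0 oner_eq0.
Qed.

(** Equal faces contain the same edge vectors, so their forms are proportional. The apex coordinate
    fixes the factor as 1 between two chosen forms, and as 0, which is absurd, against the corner
    form. *)
Lemma windmill_face_inj : injective windmill_face.
Proof.
have forms v v' : windmill_face v = windmill_face v' ->
    windmill_form v' = coord (windmill_form v') (base_vertex v) *: windmill_form v.
  move=> vv'; apply: windmill_form_ker => -[i j].
  rewrite in_tight => /andP[ij /eqP hij].
  have : windmill_face v (delta_mx 0 i + delta_mx 0 j).
    by split; [exact: edge_in_polytope|rewrite /= dot_edge].
  by rewrite vv' => -[_]; rewrite /= dot_edge.
have SN s : windmill_face (Some s) <> windmill_face None.
  move=> /forms; rewrite [X in X *: _]windmill_funE scale0r => /rowP N0.
  have := base_vertexE None; rewrite N0 mxE => /eqP.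
  by rewrite eq_sym oner_eq0.
move=> [s|] [s'|] // uu'; [|by case: (SN s)|by case: (SN s')].
congr Some; apply: chosen_inj => x.
rewrite -[LHS]windmill_funE -[RHS]windmill_funE.
have := forms _ _ uu'; rewrite [X in X *: _]windmill_funE scale1r /=.
by move=> ->.
Qed.

Lemma windmill_dim : has_dim (edge_polytope R windmill) (3 * k + r).
Proof. exact: has_dim_trivial_ker card_windmill windmill_ker. Qed.

Lemma windmill_many_facets m : has_facets R windmill m -> (4 ^ k < m)%N.
Proof.
move=> /(card_finite_inj windmill_face_inj windmill_facet).
by rewrite card_option card_ffun card_option !card_ord.
Qed.

End Functionals.
End Windmill.

(** * Existence of the maximum and both bounds *)

Theorem theorem5p4 (R : realType) (d : nat) (hd : (3 <= d)%N) :
  exists m : nat,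
    is_max_facets R d m /\ (4 ^ (d %/ 3) < m)%N /\ (m <= 2 ^ d + d)%N.
Proof.
pose attained m := exists (n : nat) (G : graph n),
  [/\ connected_graph G, has_dim (edge_polytope R G) d & has_facets R G m].
have bounded n (G : graph n) k : connected_graph G ->
    has_dim (edge_polytope R G) d -> has_facets R G k -> (k <= 2 ^ d + d)%N.
  move=> conG dimG Gk; have [m Gm mle] := facets_upper_bound conG hd dimG.
  suff -> : k = m by [].
  by apply/card_eq_II; rewrite -(card_eqr Gm) card_eq_sym.
have k_gt0 : (0 < d %/ 3)%N by rewrite divn_gt0.
have dE : (3 * (d %/ 3) + d %% 3 = d)%N by rewrite mulnC -divn_eq.
pose W := windmill (d %% 3) k_gt0.
have conW : connected_graph W by exact: windmill_connected.
have dimW : has_dim (edge_polytope R W) d.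
  by rewrite -[X in has_dim _ X]dE; exact: windmill_dim.
(* The upper bound also provides the facet number [w] of the windmill, so the attained numbers are
   nonempty as well as bounded and have a maximum. *)
have [w Ww _] := facets_upper_bound conW hd dimW.
have attw : `[< attained w >] by apply/asboolP; exists _, W.
have attb m : `[< attained m >] -> (m <= 2 ^ d + d)%N.
  by move=> /asboolP[n [G [conG dimG Gm]]]; exact: bounded Gm.
case: (ex_maxnP (ex_intro _ w attw) attb) => m attm maxm.
exists m; split; [split|split].
- exact/asboolP.
- by move=> n G k conG dimG Gk; apply: maxm; apply/asboolP; exists n, G.
- by apply: leq_trans (maxm _ attw); exact: windmill_many_facets Ww.
- exact: attb.
Qed.
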